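(* Let $N\ge 1$, $0<s<1$ and $1<p<\infty$ be such that $s\,p>N$, and define \[ \theta_{N,s,p}:=\omega_N\,\sup_{T>1} \frac{(T-1)^N}{\Big((T-1)^s+T^s\Big)^p}. \] Then \[ \theta_{N,s,p}\,\Lambda_{s,p}(B_1(0))\le\mathfrak{m}_{s,p}(\mathbb{R}^N). \]
   Context: $\omega_N$ is the Lebesgue measure of the unit ball $B_1(0)\subseteq\mathbb{R}^N$. For an open set $\Omega$ and $0<s<1$, $[\varphi]_{W^{s,p}(\Omega)}=\left(\iint_{\Omega\times\Omega}\frac{|\varphi(x)-\varphi(y)|^p}{|x-y|^{N+s\,p}}dx\,dy\right)^{1/p}$. For $0<\alpha\le1$ and $E\subseteq\mathbb{R}^N$, $[\varphi]_{C^{0,\alpha}(E)}=\sup_{x,y\in E,\,x\ne y}\frac{|\varphi(x)-\varphi(y)|}{|x-y|^\alpha}$. Set $\alpha_{s,p}=s-N/p$. The sharp Morrey constant is $\mathfrak{m}_{s,p}(\mathbb{R}^N)=\inf\{[\varphi]^p_{W^{s,p}(\mathbb{R}^N)}:\varphi\in C^\infty_0(\mathbb{R}^N),\ [\varphi]_{C^{0,\alpha_{s,p}}(\mathbb{R}^N)}=1\}$. For a ball $B_r(x_0)$, $\Lambda_{s,p}(B_r(x_0))=\inf\{[\varphi]^p_{W^{s,p}(B_r(x_0))}:\varphi\in C^1(\overline{B_r(x_0)}),\ \|\varphi\|_{L^p(B_r(x_0))}=1,\ \varphi(x_0)=0\}$. *)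

(* Defs.v *)
From HB Require Import structures.
From mathcomp Require Import all_boot all_order all_algebra.
From mathcomp Require Import all_classical all_reals all_analysis.
Set Implicit Arguments. Unset Strict Implicit. Unset Printing Implicit Defensive.
Import Order.TTheory GRing.Theory Num.Theory.
Import numFieldNormedType.Exports.
Local Open Scope classical_set_scope.
Local Open Scope ring_scope.

Section Defs.
Variable R : realType.

(* Euclidean norm on R^N (the library norm on matrices is the sup norm). *)
Definition enorm (N : nat) (x : 'rV[R]_N) : R :=
  Num.sqrt (\sum_(i < N) x ord0 i ^+ 2).

Definition eball (N : nat) (x0 : 'rV[R]_N) (r : R) : set 'rV[R]_N :=
  [set x | enorm (x - x0) < r].

Definition evec (N : nat) (i : 'I_N) : 'rV[R]_N := delta_mx ord0 i.

(* Lebesgue integral over R^N of a function with values in \bar R,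
   defined as the iterated one-dimensional Lebesgue integral
   (equal to the integral w.r.t. N-dimensional Lebesgue measure for
   nonnegative measurable integrands, by Tonelli). *)
Fixpoint lebN (n : nat) : ('rV[R]_n -> \bar R) -> \bar R :=
  match n return ('rV[R]_n -> \bar R) -> \bar R with
  | 0 => fun f => f 0
  | n'.+1 => fun f =>
      (\int[@lebesgue_measure R]_t
         lebN (fun v : 'rV[R]_n' => f (row_mx (\row_(j < 1) t) v)))%E
  end.

Definition omega (N : nat) : \bar R := lebN (fun x : 'rV[R]_N => (\1_(eball 0 1) x)%:E).

Definition gagliardo_p (N : nat) (s p : R) (Om : set 'rV[R]_N)
  (phi : 'rV[R]_N -> R) : \bar R :=
  lebN (fun x : 'rV[R]_N => lebN (fun y : 'rV[R]_N =>
    (\1_Om x * \1_Om y *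
      (`|phi x - phi y| `^ p / enorm (x - y) `^ (N%:R + s * p)))%:E)).

Definition Lpnorm (N : nat) (p : R) (E : set 'rV[R]_N) (phi : 'rV[R]_N -> R)
  : \bar R :=
  ((lebN (fun x : 'rV[R]_N => (\1_E x * `|phi x| `^ p)%:E)) `^ p^-1)%E.

Definition holder_semi (N : nat) (alpha : R) (E : set 'rV[R]_N)
  (phi : 'rV[R]_N -> R) : \bar R :=
  ereal_sup [set (`|phi xy.1 - phi xy.2| / enorm (xy.1 - xy.2) `^ alpha)%:E
            | xy in [set xy : 'rV[R]_N * 'rV[R]_N |
                       [/\ E xy.1, E xy.2 & xy.1 <> xy.2]]].

Definition iter_partial (N : nat) (l : seq 'I_N) (f : 'rV[R]_N -> R)
  : 'rV[R]_N -> R :=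
  foldr (fun i g => 'D_(evec i) g) f l.

Definition smooth (N : nat) (f : 'rV[R]_N -> R) : Prop :=
  forall l : seq 'I_N,
    continuous (iter_partial l f) /\
    forall (i : 'I_N) (x : 'rV[R]_N), derivable (iter_partial l f) x (evec i).

Definition compact_support (N : nat) (f : 'rV[R]_N -> R) : Prop :=
  compact (closure [set x | f x != 0]).

Definition C1_closure (N : nat) (Om : set 'rV[R]_N) (phi : 'rV[R]_N -> R)
  : Prop :=
  {within closure Om, continuous phi} /\
  forall i : 'I_N,
    (forall x, Om x -> derivable phi x (evec i)) /\
    exists g : 'rV[R]_N -> R,
      {within closure Om, continuous g} /\
      forall x, Om x -> 'D_(evec i) phi x = g x.

Definition morrey_const (N : nat) (s p : R) : \bar R :=
  ereal_inf [set gagliardo_p s p setT phi | phi in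
    [set phi : 'rV[R]_N -> R | [/\ smooth phi, compact_support phi &
        holder_semi (s - N%:R / p) setT phi = 1%E]]].

Definition Lambda (N : nat) (s p : R) (x0 : 'rV[R]_N) (r : R) : \bar R :=
  ereal_inf [set gagliardo_p s p (eball x0 r) phi | phi in
    [set phi : 'rV[R]_N -> R | [/\ C1_closure (eball x0 r) phi,
        Lpnorm p (eball x0 r) phi = 1%E & phi x0 = 0]]].

Definition theta (N : nat) (s p : R) : \bar R :=
  (omega N * ereal_sup [set ((T - 1) ^+ N / ((T - 1) `^ s + T `^ s) `^ p)%R%:E
                        | T in [set T : R | (1 < T)%R]])%E.

End Defs.

(* Main.v *)
(** Let [phi] be an admissible function, [x0 <> y0], [d = |x0 - y0|] and [T > 1].
    Translating and dilating, the definition of [Lambda] gives the Poincare inequality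
    [Lambda * int_{B_r(x)} |phi - phi x|^p <= r^(s p) [phi]^p] on every ball.
    The ball [B] of radius [(T - 1) d] around [y0] is contained in the ball of radius
    [T d] around [x0]; integrating over [B] the convexity inequality
    [|phi x0 - phi y0|^p <= k1 |phi - phi x0|^p + k2 |phi - phi y0|^p], whose weights are
    proportional to [T^s] and [(T - 1)^s], and applying the Poincare inequality on both
    balls, yields
    [Lambda omega ((T - 1) d)^N |phi x0 - phi y0|^p
       <= ((T - 1)^s + T^s)^p d^(s p) [phi]^p].
    Dividing by [d^(s p)] and taking suprema over the pairs [x0, y0] and over [T]
    concludes.

    Measurability: the integral of a nonnegative function is the supremum of the
    integrals of the simple functions below it, so the iterated integral [lebN] is
    monotone, homogeneous and transforms correctly under dilations with no measurability
    assumption. Additivity is only used for lower semicontinuous integrands, a class which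
    by Fatou's lemma is stable under partial integration. *)
Require Import Defs.
From HB Require Import structures.
From mathcomp Require Import all_boot all_order all_algebra.
From mathcomp Require Import all_classical all_reals all_analysis.
From mathcomp Require Import measurable_realfun ring lra.
Import Order.TTheory GRing.Theory Num.Theory.
Import numFieldNormedType.Exports.
Import HBNNSimple.
Local Open Scope classical_set_scope.
Local Open Scope ring_scope.

(** * Lower integrals on the line *)

Section LowerIntegral.
Set Implicit Arguments.
Unset Strict Implicit.
Variable R : realType.
Local Open Scope ereal_scope.
Notation mu := (@lebesgue_measure R).
Implicit Types f g : R -> \bar R.

(** The integral of a nonnegative function is the supremum over the simple functions below it. Upper
    bounds can therefore be tested on simple functions, which are measurable even if [f] is not. *)
Lemma integral_le_nnsfun f M : (forall x, 0 <= f x) ->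
  (forall h : {nnsfun (measurableTypeR R) >-> R},
     (forall x, (h x)%:E <= f x) -> \int[mu]_x (h x)%:E <= M) ->
  \int[mu]_x f x <= M.
Proof.
move=> f0 hM; rewrite ge0_integralTE//; apply: ge_ereal_sup => _ [h hf <-].
by rewrite -integralT_nnsfun; exact: hM.
Qed.

Lemma le_integral_nnsfun f (h : {nnsfun (measurableTypeR R) >-> R}) :
  (forall x, (h x)%:E <= f x) -> \int[mu]_x (h x)%:E <= \int[mu]_x f x.
Proof.
move=> hf; rewrite integralT_nnsfun ge0_integralTE; last first.
  by move=> x; apply: le_trans (hf x); rewrite lee_fin.
by apply: ereal_sup_ubound => /=; exists h.
Qed.

Lemma le_integralT f g : (forall x, 0 <= f x) -> (forall x, f x <= g x) ->
  \int[mu]_x f x <= \int[mu]_x g x.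
Proof.
move=> f0 fg; apply: integral_le_nnsfun => // h hf.
by apply: le_integral_nnsfun => x; exact: le_trans (hf x) (fg x).
Qed.

(** Dividing a simple function below [k * g] by [k] gives one below [g], whence [aux]. The reverse
    inequality is [aux] with factor [c^-1], applied to [c * f]. *)
Lemma integralTZl f (c : R) : (0 < c)%R -> (forall x, 0 <= f x) ->
  \int[mu]_x (c%:E * f x) = c%:E * \int[mu]_x f x.
Proof.
have aux k g : (0 < k)%R -> (forall x, 0 <= g x) ->
    \int[mu]_x (k%:E * g x) <= k%:E * \int[mu]_x g x.
  move=> k0 g0; apply: integral_le_nnsfun => [x|h hg].
    by rewrite mule_ge0// lee_fin ltW.
  have ki0 : (0 <= k^-1)%R by rewrite invr_ge0 ltW.
  have := @le_integral_nnsfun g (scale_nnsfun h ki0).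
  rewrite /= (_ : \int[mu]_x (k^-1 * h x)%:E = k^-1%:E * \int[mu]_x (h x)%:E);
    last first.
    under eq_integral do rewrite EFinM.
    rewrite ge0_integralZl_EFin//; first by move=> x _; rewrite lee_fin.
    exact/measurable_EFinP.
  rewrite lee_pdivrMl//; apply=> x.
  by rewrite EFinM lee_pdivrMl.
move=> c0 f0; apply/eqP; rewrite eq_le aux//=.
rewrite -lee_pdivlMl//; apply: le_trans (aux _ _ _ _); last 2 first.
- by rewrite invr_gt0.
- by move=> x; rewrite mule_ge0// lee_fin ltW.
rewrite le_eqVlt; apply/orP; left; apply/eqP; apply: eq_integral => x _.
by rewrite muleA -EFinM mulVf ?gt_eqF// mul1e.
Qed.

Let affine (a r : R) :=
  (fun t : R => (a + r * t)%R) : measurableTypeR R -> measurableTypeR R.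

Let measurable_affine a r : measurable_fun setT (affine a r).
Proof.
by apply: measurable_funD => //; exact: measurable_funM.
Qed.

(** By uniqueness of Lebesgue measure it suffices to check half-open intervals, whose preimage under
    [t |-> a + r * t] is shorter by the factor [r]. *)
Lemma lebesgue_measure_affine (a r : R) (r0 : (0 <= r)%R) (A : set (measurableTypeR R)) :
  r != 0%R -> measurable A ->
  mu A = pushforward (mscale (NngNum r0) mu) (affine a r) A.
Proof.
move=> rn0 mA; have {rn0} rp : (0 < r)%R by rewrite lt_neqAle eq_sym rn0.
apply: lebesgue_measure_unique mA => _ [[c d]] _ <-.
rewrite /= /pushforward/= /mscale/=.
have -> : affine a r @^-1` `]c, d] =
    `](r^-1 * (c - a))%R, (r^-1 * (d - a))%R]%classic.
  apply/seteqP; split => t; rewrite /= !in_itv/= /affine;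
  by rewrite ltr_pdivrMl// ler_pdivlMl// ltrBlDl lerBrDl.
rewrite !lebesgue_measure_itv/= !lte_fin ltr_pM2l ?invr_gt0//.
rewrite ltrD2r; case: ifP => _; last by rewrite mule0.
by rewrite -EFinM -mulrBr mulrA mulfV ?gt_eqF// mul1r; congr EFin; lra.
Qed.

(** The classical change of variables [auxm] is applied only to simple functions composed with the
    inverse map [ai]; this yields [aux] for arbitrary nonnegative [g]. Equality follows by using
    [aux] also for the inverse affine map. *)
Lemma integralT_affine f (a r : R) : (0 < r)%R -> (forall x, 0 <= f x) ->
  \int[mu]_t f (a + r * t)%R = r^-1%:E * \int[mu]_t f t.
Proof.
have auxm g b k : (0 < k)%R -> (forall x, 0 <= g x) ->
    measurable_fun [set: measurableTypeR R] g ->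
    \int[mu]_t g (b + k * t)%R = k^-1%:E * \int[mu]_t g t.
  move=> k0 g0 mg; have k0' := ltW k0.
  have -> : \int[mu]_t g t =
      \int[pushforward (mscale (NngNum k0') mu) (affine b k)]_t g t.
    apply: eq_measure_integral => A mA _.
    by apply: lebesgue_measure_affine; rewrite ?gt_eqF.
  rewrite ge0_integral_pushforward//=.
  rewrite preimage_setT ge0_integral_mscale//=; last first.
    by apply: measurableT_comp => //; exact: measurable_affine.
  by rewrite muleA -EFinM mulVf ?gt_eqF// mul1e.
have aux g b k : (0 < k)%R -> (forall x, 0 <= g x) ->
    \int[mu]_t g (b + k * t)%R <= k^-1%:E * \int[mu]_t g t.
  move=> k0 g0; apply: integral_le_nnsfun => [//|h hg].
  pose ai t := affine (- (k^-1 * b))%R k^-1%R t.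
  have -> : \int[mu]_t (h t)%:E = \int[mu]_t (h (ai (b + k * t)%R))%:E.
    apply: eq_integral => t _; congr (h _)%:E; rewrite /ai /affine.
    by rewrite mulrDr mulrA mulVf ?gt_eqF// mul1r addKr.
  rewrite (auxm (fun t => (h (ai t))%:E))//.
  - rewrite lee_pmul2l ?lte_fin ?invr_gt0//; apply: le_integralT => t.
      by rewrite lee_fin.
    apply: le_trans (hg _) _; rewrite /ai /affine mulrDr mulrA mulrN.
    by rewrite mulrA mulfV ?gt_eqF// !mul1r addrA subrr add0r.
  - by move=> t; rewrite lee_fin.
  - apply/measurable_EFinP; apply: measurableT_comp => //.
    exact: measurable_affine.
move=> r0 f0; apply/eqP; rewrite eq_le aux//=.
rewrite lee_pdivrMl//.
have := aux (fun t => f (a + r * t)%R) (- (r^-1 * a))%R r^-1%R.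
rewrite invr_gt0 invrK => /(_ r0 (fun=> f0 _)); apply: le_trans.
rewrite le_eqVlt; apply/orP; left; apply/eqP; apply: eq_integral => x _.
congr f; rewrite mulrDr mulrN !mulrA mulfV ?gt_eqF//; lra.
Qed.
End LowerIntegral.

(** * The iterated integral *)

Section LebN.
Set Implicit Arguments.
Unset Strict Implicit.
Variable R : realType.
Local Open Scope ereal_scope.
Notation mu := (@lebesgue_measure R).

Notation consv t v := (row_mx (\row_(j < 1) t) v).

Lemma lebN_ge0 n (f : 'rV[R]_n -> \bar R) : (forall x, 0 <= f x) -> 0 <= lebN f.
Proof.
elim: n f => [|n IH] f f0 /=; first exact: f0.
by apply: integral_ge0 => t _; apply: IH.
Qed.

Lemma le_lebN n (f g : 'rV[R]_n -> \bar R) :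
  (forall x, 0 <= f x) -> (forall x, f x <= g x) -> lebN f <= lebN g.
Proof.
elim: n f g => [|n IH] f g f0 fg /=; first exact: fg.
apply: le_integralT => t; first exact: lebN_ge0.
exact: IH.
Qed.

Lemma eq_lebN n (f g : 'rV[R]_n -> \bar R) : f =1 g -> lebN f = lebN g.
Proof. by move=> /funext ->. Qed.

Lemma lebNZl n (f : 'rV[R]_n -> \bar R) (c : R) :
  (0 < c)%R -> (forall x, 0 <= f x) ->
  lebN (fun x => c%:E * f x) = c%:E * lebN f.
Proof.
elim: n f => [//|n IH] f c0 f0 /=.
under eq_integral do rewrite (IH (fun v => f (consv _ v)))//.
by rewrite integralTZl// => t; exact: lebN_ge0.
Qed.

Lemma lebN_affine n (f : 'rV[R]_n -> \bar R) (a : 'rV[R]_n) (r : R) :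
  (0 < r)%R -> (forall x, 0 <= f x) ->
  lebN (fun x => f (a + r *: x)%R) = (r ^- n)%:E * lebN f.
Proof.
elim: n f a => [|n IH] f a r0 f0.
  by rewrite /= expr0 invr1 mul1e; congr f; apply/rowP => -[].
have E t v : (a + r *: consv t v =
    consv (lsubmx (a : 'rV_(1 + n)) 0 0 + r * t) (rsubmx (a : 'rV_(1 + n)) + r *: v))%R.
  rewrite -{1}[a](@hsubmxK _ 1 1 n) scale_row_mx.
  apply: etrans (@add_row_mx _ 1 1 n _ _ _ _) _; congr row_mx.
  by apply/rowP => i; rewrite !mxE !ord1.
rewrite /=.
under eq_integral.
  move=> t _; rewrite (eq_lebN (fun v => congr1 f (E t v))).
  rewrite (IH (fun v => f (consv (_ + r * t)%R v)))//.
  over.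
rewrite integralTZl ?invr_gt0 ?exprn_gt0//; last by move=> t; exact: lebN_ge0.
rewrite (integralT_affine (f := fun t => lebN (fun v => f (consv t v))) _ _)//; last first.
  by move=> t; exact: lebN_ge0.
by rewrite muleA -EFinM exprSr invfM mulrC.
Qed.

(** An integrand bounded by [M] and supported in a cube of side [2 b] has integral at most [M] times
    the volume of the cube; this gives finiteness of integrals over balls. *)
Lemma lebN_cube_le n (f : 'rV[R]_n -> \bar R) (c : 'rV[R]_n) (b M : R) :
  (0 <= b)%R -> (0 <= M)%R -> (forall x, 0 <= f x <= M%:E) ->
  (forall (x : 'rV[R]_n) i, (b < `|x ord0 i - c ord0 i|)%R -> f x = 0) ->
  lebN f <= (M * (b *+ 2) ^+ n)%:E.
Proof.
move=> b0; elim: n f c M => [|n IH] f c M M0 fM fb /=.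
  by rewrite expr0 mulr1; case/andP: (fM 0%R).
pose c0 := lsubmx (c : 'rV_(1 + n)) 0%R 0%R.
have L t : lebN (fun v => f (consv t v)) <=
    (M * (b *+ 2) ^+ n)%:E * (\1_`[(c0 - b)%R, (c0 + b)%R] t)%:E.
  rewrite indicE; case: (boolP (t \in _)) => tI.
    rewrite mule1; apply: (IH _ (rsubmx (c : 'rV_(1 + n)))) => // x i xi.
    apply: (fb _ (rshift 1 i)).
    by rewrite (_ : consv t x _ _ = x ord0 i) ?[LHS]row_mxEr//; move: xi; rewrite mxE.
  rewrite mule0; rewrite (_ : lebN _ = 0)//.
  apply/eqP; rewrite eq_le lebN_ge0 ?andbT; last by move=> v; case/andP: (fM (consv t v)).
  have f00 v : f (consv t v) = 0.
    apply: (fb (consv t v) (lshift n (ord0 : 'I_1))).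
    rewrite (_ : consv t v _ _ = t) ?[LHS]row_mxEl ?mxE// ltNge; apply: contra tI.
    by rewrite inE/= in_itv/= ler_distl /c0 mxE.
  (* The section vanishes identically outside the slab; the induction hypothesis with bound 0 shows
     that its integral is 0. *)
  rewrite (eq_lebN f00); have := IH (fun=> 0) 0%R 0%R; rewrite mul0r; apply => //.
  by move=> _; rewrite lexx.
apply: (@le_trans _ _ (\int[mu]_t
    ((M * (b *+ 2) ^+ n)%:E * (\1_`[(c0 - b)%R, (c0 + b)%R] t)%:E))).
  apply: le_integralT => // t.
  by apply: lebN_ge0 => v; case/andP: (fM (consv t v)).
have Mn0 : (0 <= M * (b *+ 2) ^+ n)%R by rewrite mulr_ge0// exprn_ge0// mulrn_wge0.
rewrite ge0_integralZl//=; last first.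
  by apply/measurable_EFinP; exact: measurable_indic.
rewrite integral_indic//= setIT lebesgue_measure_itv/= lte_fin.
case: ifP => _; last by rewrite mule0 lee_fin mulr_ge0// exprn_ge0// mulrn_wge0.
by rewrite -EFinB -EFinM lee_fin exprSr mulrA; apply: ler_wpM2l => //; lra.
Qed.

(** * Lower semicontinuous integrands: Fatou's lemma and additivity *)

Lemma lee_by_reals (x y : \bar R) :
  (forall a : R, a%:E < x -> a%:E <= y) -> x <= y.
Proof.
move=> H; rewrite leNgt; apply/negP => yx.
case: y x H yx => [r| |] [r'| |] H //; rewrite ?lte_fin.
- move=> rr; have := H ((r + r') / 2)%R; rewrite lte_fin lee_fin => /(_ _); lra.
- move=> _; have := H (r + 1)%R; rewrite ltry lee_fin => /(_ _); lra.
- by move=> _; have := H (r' - 1)%R; rewrite lte_fin => /(_ ltac:(lra)).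
- by move=> _; have := H 0%R; rewrite ltry => /(_ isT).
Qed.

Lemma limn_einf_ge (u : (\bar R)^nat) (x : \bar R) :
  (forall a : R, a%:E < x -> \forall k \near \oo, a%:E <= u k) ->
  x <= limn_einf u.
Proof.
move=> H; apply: lee_by_reals => a /H [m _ mu_].
rewrite limn_einf_lim; apply: lime_ge; first exact: is_cvg_einfs.
exists m => // k /= mk; apply: le_ereal_inf_tmp => _ [j /= kj <-].
by apply: mu_ => /=; exact: leq_trans mk kj.
Qed.

Lemma limn_einf_le_cst (u : (\bar R)^nat) (x : \bar R) :
  (forall k, u k <= x) -> limn_einf u <= x.
Proof.
move=> H; rewrite limn_einf_lim; apply: lime_le; first exact: is_cvg_einfs.
by exists 0%N => // k _; apply: le_trans (H k); apply: ereal_inf_lbound; exists k => /=.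
Qed.

(** If every ball of radius [1 / (k + 1)] contained a point with [g <= a], these points would form a
    sequence tending to [t] along which the lower limit is at most [a]. The sequential form is the
    one that Fatou's lemma delivers. *)
Lemma lsc_seq (g : R -> \bar R) :
  (forall (t : R) (u : R^nat), u @ \oo --> t -> g t <= limn_einf (g \o u)) ->
  lower_semicontinuous g.
Proof.
move=> H t a agt; apply: contrapT => nV.
have ex k : exists y : R, ball t k.+1%:R^-1 y /\ g y <= a%:E.
  apply: contrapT => nk; apply: nV; exists (ball t k.+1%:R^-1).
    by apply: nbhsx_ballx; rewrite invr_gt0.
  move=> y ty; rewrite ltNge; apply/negP => gy; apply: nk.
  by exists y.
have /choice [u Hu] := ex.
have : g t <= a%:E.
  apply: le_trans (H t u _) _; last by apply: limn_einf_le_cst => k; have [] := Hu k.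
  apply/cvgrPdist_lt => e e0; near=> k.
  have [+ _] := Hu k; rewrite /ball/= => /lt_le_trans; apply.
  near: k; by apply: filterS (near_infty_natSinv_lt (PosNum e0)) => k /ltW.
by rewrite leNgt agt.
Unshelve. all: by end_near. Qed.

Lemma ball_row_mx n (t t' e : R) (v v' : 'rV[R]_n) :
  ball t e t' -> ball v e v' ->
  ball (consv t v : 'rV[R]_n.+1) e (consv t' v').
Proof.
move=> tt [e0 vv]; split => // i j; rewrite !ord1.
have := splitP (j : 'I_(1 + n)); case=> k jk.
  have -> : j = lshift n k by exact: val_inj.
  have E (x : R) (w : 'rV[R]_n) : (consv x w) ord0 (lshift n k) = x.
    by rewrite [LHS]row_mxEl mxE.
  by rewrite !E.
have -> : j = rshift 1 k by exact: val_inj.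
have E (x : R) (w : 'rV[R]_n) : (consv x w) ord0 (rshift 1 k) = w ord0 k.
  by rewrite [LHS]row_mxEr.
by rewrite !E.
Qed.

Lemma lsc_section_einf n (f : 'rV[R]_n.+1 -> \bar R) (t : R) (u : R^nat) (v : 'rV[R]_n) :
  lower_semicontinuous f -> u @ \oo --> t ->
  f (consv t v) <= limn_einf (fun k => f (consv (u k) v)).
Proof.
move=> lf ut; apply: limn_einf_ge => a /lf [V /nbhs_ballP [e e0 eV] Va].
have /cvgrPdist_lt /(_ _ e0) := ut; apply: filterS => k tk.
apply/ltW/Va/eV/ball_row_mx => //.
exact: ballxx.
Qed.

Lemma lsc_section n (f : 'rV[R]_n.+1 -> \bar R) (t : R) :
  lower_semicontinuous f -> lower_semicontinuous (fun v : 'rV[R]_n => f (consv t v)).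
Proof.
move=> lf v a /lf [V /nbhs_ballP [e e0 eV] Va].
exists (ball v e); first exact: nbhsx_ballx.
by move=> w vw; apply/Va/eV/ball_row_mx => //; exact: ballxx.
Qed.

(** Fatou's lemma on the line needs measurable partial integrals. The induction hypothesis provides
    them: applied to the sections at [u m] with [u] tending to [t], it makes each partial integral
    lower semicontinuous in [t]. *)
Lemma lebN_fatou n (F : nat -> 'rV[R]_n -> \bar R) (f : 'rV[R]_n -> \bar R) :
  (forall k, lower_semicontinuous (F k)) ->
  (forall k x, 0 <= F k x) -> (forall x, 0 <= f x) ->
  (forall x, f x <= limn_einf (fun k => F k x)) ->
  lebN f <= limn_einf (fun k => lebN (F k)).
Proof.
elim: n F f => [|n IH] F f lF F0 f0 fF /=; first exact: fF.
have mF k : measurable_fun [set: measurableTypeR R] (fun t => lebN (fun v => F k (consv t v))).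
  apply: lower_semicontinuous_measurable; apply: lsc_seq => t u ut; apply: IH => // [m|v].
    exact: lsc_section.
  exact: (lsc_section_einf v (lF k) ut).
apply: le_trans (@fatou _ (measurableTypeR R) R mu setT measurableT _ mF _); last first.
  by move=> k t _; exact: lebN_ge0.
apply: le_integralT => t; first exact: lebN_ge0.
by apply: IH => // m; exact: lsc_section.
Qed.

Lemma measurable_lebN_section n (f : 'rV[R]_n.+1 -> \bar R) :
  lower_semicontinuous f -> (forall x, 0 <= f x) ->
  measurable_fun [set: measurableTypeR R] (fun t => lebN (fun v => f (consv t v))).
Proof.
move=> lf f0.
apply: lower_semicontinuous_measurable; apply: lsc_seq => t u ut.
apply: lebN_fatou => // [m|v]; first exact: lsc_section.
exact: (lsc_section_einf v lf ut).
Qed.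

Lemma lebND n (f g : 'rV[R]_n -> \bar R) :
  lower_semicontinuous f -> lower_semicontinuous g ->
  (forall x, 0 <= f x) -> (forall x, 0 <= g x) ->
  lebN (fun x => f x + g x) = lebN f + lebN g.
Proof.
elim: n f g => [//|n IH] f g lf lg f0 g0 /=.
under eq_integral.
  move=> t _; rewrite (IH (fun v => f (consv t v)) (fun v => g (consv t v)))//;
    [over|exact: lsc_section|exact: lsc_section].
rewrite ge0_integralD//.
- by move=> t _; exact: lebN_ge0.
- exact: measurable_lebN_section.
- by move=> t _; exact: lebN_ge0.
- exact: measurable_lebN_section.
Qed.

End LebN.

(** * The Euclidean norm *)

Section Enorm.
Set Implicit Arguments.
Unset Strict Implicit.
Variables (R : realType) (N : nat).
Implicit Types x y : 'rV[R]_N.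

Lemma enorm_ge0 x : 0 <= enorm x.
Proof. exact: sqrtr_ge0. Qed.

Lemma sqr_enorm x : enorm x ^+ 2 = \sum_(i < N) x ord0 i ^+ 2.
Proof. by rewrite sqr_sqrtr// sumr_ge0// => i _; exact: sqr_ge0. Qed.

Lemma enormZ (r : R) x : 0 <= r -> enorm (r *: x) = r * enorm x.
Proof.
move=> r0; apply/eqP; rewrite -(eqrXn2 (n := 2))// ?mulr_ge0 ?enorm_ge0//.
rewrite exprMn !sqr_enorm mulr_sumr; apply/eqP; apply: eq_bigr => i _.
by rewrite mxE exprMn.
Qed.

Lemma enormC x y : enorm (x - y) = enorm (y - x).
Proof.
by congr Num.sqrt; apply: eq_bigr => i _; rewrite !mxE -sqrrN opprB.
Qed.

Lemma enorm_gt0 x : x != 0 -> 0 < enorm x.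
Proof.
move=> x0; rewrite lt_neqAle enorm_ge0 andbT eq_sym; apply: contra x0.
rewrite -sqrf_eq0 sqr_enorm psumr_eq0; last by move=> i _; exact: sqr_ge0.
move=> /allP x0; apply/eqP/rowP => i; apply/eqP; rewrite mxE -sqrf_eq0.
by apply: x0; rewrite mem_index_enum.
Qed.

Lemma normr_coord_le_enorm x i : `|x ord0 i| <= enorm x.
Proof.
rewrite -sqrtr_sqr ler_sqrt; last by rewrite sumr_ge0// => j _; exact: sqr_ge0.
by rewrite (bigD1 i)//= lerDl sumr_ge0// => j _; exact: sqr_ge0.
Qed.

(* AM-GM in each coordinate, after normalising both vectors, gives Cauchy-Schwarz. *)
Lemma dotr_le_enorm x y :
  \sum_(i < N) x ord0 i * y ord0 i <= enorm x * enorm y.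
Proof.
have [->|x0] := eqVneq x 0.
  rewrite big1; first by rewrite mulr_ge0 ?enorm_ge0.
  by move=> i _; rewrite mxE mul0r.
have [->|y0] := eqVneq y 0.
  rewrite big1; first by rewrite mulr_ge0 ?enorm_ge0.
  by move=> i _; rewrite mxE mulr0.
have := enorm_gt0 x0; have := enorm_gt0 y0.
move: (sqr_enorm x) (sqr_enorm y); set a := enorm x; set b := enorm y.
move=> aE bE b0 a0.
have H : \sum_(i < N) (x ord0 i * y ord0 i) * (a * b *+ 2) <=
         \sum_(i < N) (b ^+ 2 * x ord0 i ^+ 2 + a ^+ 2 * y ord0 i ^+ 2).
  apply: ler_sum => i _; rewrite -subr_ge0.
  by have := sqr_ge0 (b * x ord0 i - a * y ord0 i); congr (0 <= _); ring.
move: H; rewrite -mulr_suml big_split/= -!mulr_sumr -aE -bE.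
have ab0 : 0 < a * b by rewrite mulr_gt0.
rewrite (_ : b ^+ 2 * _ + _ = (a * b) * (a * b *+ 2)); last by ring.
by rewrite ler_pM2r// mulrn_wgt0.
Qed.

Lemma enormD x y : enorm (x + y) <= enorm x + enorm y.
Proof.
rewrite -(ler_pXn2r (n := 2)) ?nnegrE ?addr_ge0 ?enorm_ge0//.
rewrite sqrrD !sqr_enorm.
under eq_bigr do rewrite mxE sqrrD.
rewrite !big_split/= lerD2r lerD2l.
by rewrite mulr2n lerD ?dotr_le_enorm.
Qed.

Lemma continuous_enormB (x0 : 'rV[R]_N) : continuous (fun x => enorm (x - x0)).
Proof.
move=> x; apply: (@continuous_comp _ _ _
  (fun y : 'rV[R]_N => \sum_(i < N) (y - x0) ord0 i ^+ 2) Num.sqrt); last exact: sqrt_continuous.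
move: x; apply: continuous_big => [|i _ x]; first exact: add_continuous.
rewrite (_ : (fun y : 'rV[R]_N => _) = (fun y : 'rV[R]_N => (y ord0 i - x0 ord0 i) ^+ 2)).
  apply: (@continuous_comp _ _ _ (fun y : 'rV[R]_N => y ord0 i - x0 ord0 i) (fun z => z ^+ 2)).
    exact: (cvgB (@coord_continuous R 1 N ord0 i x) (cvg_cst _)).
  exact: exprn_continuous.
by apply/funext => y; rewrite !mxE.
Qed.

Lemma open_eball (x0 : 'rV[R]_N) r : open (eball x0 r).
Proof.
rewrite (_ : eball x0 r = (fun x => enorm (x - x0)) @^-1` [set y | y < r])//.
apply: open_comp; last exact: open_lt.
by move=> x _; exact: continuous_enormB.
Qed.

Lemma eball_affine x0 x r : 0 < r -> eball x0 r (x0 + r *: x) = eball 0 1 x.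
Proof.
move=> r0; rewrite /eball/= addrAC subrr add0r subr0 enormZ ?ltW//.
by rewrite -{2}(mulr1 r) ltr_pM2l.
Qed.

Lemma sub_eball x0 y0 r : eball y0 r `<=` eball x0 (r + enorm (y0 - x0)).
Proof.
move=> x /= xy; rewrite /eball/=.
rewrite (_ : x - x0 = (x - y0) + (y0 - x0)); last by rewrite addrA subrK.
by apply: le_lt_trans (enormD _ _) _; rewrite ltrD2r.
Qed.

End Enorm.

(** * The Poincare inequality on balls *)

Section Poincare.
Set Implicit Arguments.
Unset Strict Implicit.
Variables (R : realType) (N : nat).
Implicit Types (phi : 'rV[R]_N -> R) (x : 'rV[R]_N) (p r c : R).

(** For [a >= 0] the set where the function exceeds [a] is the open set of points of [E] with [|g|]
    above the [p]-th root of [a]; for [a < 0] it is the whole space. *)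
Lemma lsc_indic_powR (E : set 'rV[R]_N) (g : 'rV[R]_N -> R) p :
  open E -> continuous g -> 0 < p ->
  lower_semicontinuous (fun x => (\1_E x * `|g x| `^ p)%:E).
Proof.
move=> oE cg p0 x a; rewrite lte_fin => ax.
have [a0|a0] := ltP a 0.
  exists setT; first exact: filterT.
  by move=> y _; rewrite lte_fin (lt_le_trans a0)// mulr_ge0 ?powR_ge0.
have Ex : E x.
  apply: contrapT => nE; move: ax; rewrite indicE memNset// mul0r => /lt_le_trans.
  by move=> /(_ _ a0); rewrite ltxx.
move: ax; rewrite indicE mem_set// mul1r => ax.
have bx : a `^ p^-1 < `|g x|.
  have := @gt0_ltr_powR R p^-1 ltac:(by rewrite invr_gt0) a (`|g x| `^ p).
  rewrite !nnegrE powR_ge0 a0 -powRrM mulfV ?gt_eqF// powRr1// => H.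
  exact: H.
exists (E `&` [set y | a `^ p^-1 < `|g y|]).
  apply: filterI; first exact: open_nbhs_nbhs.
  have := @continuous_comp _ _ _ g (fun z => `|z|) x (cg x) (@norm_continuous _ _ _).
  by move=> /cvgr_gt; apply.
move=> y [Ey gy]; rewrite lte_fin indicE mem_set// mul1r.
have := @gt0_ltr_powR R p p0 (a `^ p^-1) `|g y|.
rewrite !nnegrE powR_ge0 normr_ge0 -powRrM mulVf ?gt_eqF// powRr1//.
by apply.
Qed.

(** Transports [phi] from the ball of radius [r] around [x0] to the unit ball. With [k = phi x0] the
    result vanishes at the origin, and [c] serves to normalise the norm. *)
Definition affine_comp phi x0 r c k : 'rV[R]_N -> R :=
  fun x => c^-1 * (phi (x0 + r *: x) - k).

Lemma continuous_affine_comp phi x0 r c k :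
  continuous phi -> continuous (affine_comp phi x0 r c k).
Proof.
move=> cphi x.
have ca : {for x, continuous (fun y : 'rV[R]_N => x0 + r *: y)}.
  have H : (fun y : 'rV[R]_N => x0 + r *: y) @ x --> x0 + r *: x.
    exact: (cvgD (cvg_cst x0) (cvgZ (cvg_cst r) cvg_id)).
  exact: H.
have cc := @continuous_comp _ _ _ (fun y : 'rV[R]_N => x0 + r *: y) phi x ca (cphi _).
exact: (cvgM (cvg_cst (c^-1)) (cvgB cc (cvg_cst k))).
Qed.

Lemma is_derive_affine_comp phi x0 r c k x v :
  0 < r -> derivable phi (x0 + r *: x) v ->
  is_derive x v (affine_comp phi x0 r c k) (c^-1 * r * 'D_v phi (x0 + r *: x)).
Proof.
move=> r0 dphi.
suff H : (fun h => h^-1 *: ((affine_comp phi x0 r c k \o shift x) (h *: v) -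
    affine_comp phi x0 r c k x)) @ 0^' --> c^-1 * r * 'D_v phi (x0 + r *: x).
  by apply: DeriveDef; [apply/cvg_ex; eexists; exact: H|exact/cvg_lim].
(* The difference quotient with increment [h] is [c^-1 * r] times that of [phi] with increment
   [h * r], which also tends to 0 without vanishing. *)
have dr : (fun h : R => h * r) @ 0^' --> 0^'.
  move=> A /= [e /= e0 eA]; exists (e / r) => /=; first by rewrite divr_gt0.
  move=> h /=; rewrite !sub0r !normrN ltr_pdivlMr// => he hn0; apply: eA => /=.
    by rewrite sub0r normrN normrM (gtr0_norm r0).
  by rewrite mulf_neq0// gt_eqF.
have H := cvg_comp _ _ dr dphi.
rewrite (_ : (fun h => _) = (fun h => (c^-1 * r) *:
    ((h * r)^-1 *: ((phi \o shift (x0 + r *: x)) ((h * r) *: v) -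
    phi (x0 + r *: x))))).
  by apply: cvgZ; [exact: cvg_cst|exact: H].
apply/funext => h /=; rewrite /affine_comp.
rewrite (_ : x0 + r *: (h *: v + x) = (h * r) *: v + (x0 + r *: x)); last first.
  by rewrite scalerDr scalerA mulrC addrCA.
rewrite /GRing.scale/= invfM.
(* The quotients are compared as functions, so [h = 0] is included; there both sides are 0 because
   the inverse of 0 is 0. *)
have [->|h0] := eqVneq h 0; first by rewrite !invr0 !(mul0r, mulr0).
by move: (c^-1) => d; field; rewrite h0 gt_eqF.
Qed.

Lemma C1_closure_affine_comp (Om : set 'rV[R]_N) phi x0 r c k :
  0 < r -> smooth phi -> C1_closure Om (affine_comp phi x0 r c k).
Proof.
move=> r0 sphi; have [cphi dphi] := sphi [::].
split; first exact/continuous_subspaceT/continuous_affine_comp.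
move=> i; split=> [x _|].
  by have [] := is_derive_affine_comp c k r0 (dphi i (x0 + r *: x)).
(* The chain rule factor [c^-1 * r] is the inverse of [c / r], so the derivative is again of the
   form [affine_comp]. *)
exists (affine_comp ('D_(evec R i) phi) x0 r (c / r) 0); split.
  apply/continuous_subspaceT/continuous_affine_comp.
  by have [] := sphi [:: i].
move=> x _; have [_ ->] := is_derive_affine_comp c k r0 (dphi i (x0 + r *: x)).
by rewrite /affine_comp subr0 invfM invrK.
Qed.

(** * Gagliardo seminorm: monotonicity and scaling *)

Lemma gagliardo_ge0 (s p : R) (Om : set 'rV[R]_N) phi :
  (0 <= gagliardo_p s p Om phi)%E.
Proof.
apply: lebN_ge0 => x; apply: lebN_ge0 => y; rewrite lee_fin.
by apply: mulr_ge0; [rewrite mulr_ge0|rewrite divr_ge0 ?powR_ge0].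
Qed.

Lemma le_gagliardo_setT (s p : R) (Om : set 'rV[R]_N) phi :
  (gagliardo_p s p Om phi <= gagliardo_p s p setT phi)%E.
Proof.
have F0 (x y : 'rV[R]_N) : 0 <= `|phi x - phi y| `^ p / enorm (x - y) `^ (N%:R + s * p).
  by rewrite divr_ge0 ?powR_ge0.
apply: le_lebN => x.
  by apply: lebN_ge0 => y; rewrite lee_fin; apply: mulr_ge0 => //; rewrite mulr_ge0.
apply: le_lebN => y; first by rewrite lee_fin; apply: mulr_ge0 => //; rewrite mulr_ge0.
rewrite lee_fin; apply: ler_wpM2r => //.
by rewrite !indicT/= mulr1 mulr_ile1// indicE; case: (_ \in _).
Qed.

Lemma lebN2_affine (K : 'rV[R]_N -> 'rV[R]_N -> R) x0 r (C : R) :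
  0 < r -> 0 < C -> (forall x y, 0 <= K x y) ->
  lebN (fun x => lebN (fun y => (C * K (x0 + r *: x) (x0 + r *: y))%:E)) =
  ((C * r ^- N * r ^- N)%:E * lebN (fun x => lebN (fun y => (K x y)%:E)))%E.
Proof.
move=> r0 C0 K0; have rN : 0 < r ^- N by rewrite invr_gt0 exprn_gt0.
have KE x : (forall y, 0 <= (K x y)%:E)%E by move=> y; rewrite lee_fin.
have LK x : (0 <= lebN (fun y => (K x y)%:E))%E by exact: lebN_ge0.
transitivity (lebN (fun x => ((C * r ^- N)%:E *
    lebN (fun y => (K (x0 + r *: x) y)%:E))%E)).
  apply: eq_lebN => x.
  have := lebN_affine x0 r0 (KE (x0 + r *: x)).
  have := lebNZl (f := fun y => (K (x0 + r *: x) (x0 + r *: y))%:E) C0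
    (fun y => KE (x0 + r *: x) (x0 + r *: y)).
  by move=> E1 E2; rewrite EFinM -muleA -E2 -E1.
have := lebN_affine x0 r0 LK.
have := lebNZl (f := fun x => lebN (fun y => (K (x0 + r *: x) y)%:E))
  (mulr_gt0 C0 rN) (fun x => LK (x0 + r *: x)).
by move=> -> ->; rewrite muleA EFinM.
Qed.

(** The values of the function contribute [c^-1] to the power [p], the kernel contributes [r] to the
    power [N + s p], and each of the two changes of variables contributes [r ^- N]. *)
Lemma gagliardo_affine_comp (s p : R) phi x0 r c k :
  0 < r -> 0 < c ->
  gagliardo_p s p setT (affine_comp phi x0 r c k) =
  ((c^-1 `^ p * r `^ (N%:R + s * p) * r ^- N * r ^- N)%:E *
   gagliardo_p s p setT phi)%E.
Proof.
move=> r0 c0; rewrite /gagliardo_p.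
pose K (x y : 'rV[R]_N) := `|phi x - phi y| `^ p / enorm (x - y) `^ (N%:R + s * p).
have K0 x y : 0 <= K x y by rewrite divr_ge0 ?powR_ge0.
have E (x y : 'rV[R]_N) :
    (\1_(@setT 'rV[R]_N) x * \1_(@setT 'rV[R]_N) y *
      (`|affine_comp phi x0 r c k x - affine_comp phi x0 r c k y| `^ p
        / enorm (x - y) `^ (N%:R + s * p))) =
    (c^-1 `^ p * r `^ (N%:R + s * p)) * K (x0 + r *: x) (x0 + r *: y).
  rewrite !indicT/= !mul1r /affine_comp /K -mulrBr opprB addrA subrK.
  rewrite (_ : x0 + r *: x - _ = r *: (x - y)); last first.
    by rewrite scalerBr opprD addrACA subrr add0r.
  rewrite enormZ ?ltW//.
  rewrite normrM (gtr0_norm (_ : 0 < c^-1)) ?invr_gt0//.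
  rewrite !powRM ?normr_ge0 ?enorm_ge0 ?invr_ge0 ?(ltW r0) ?(ltW c0)// invfM.
  have : r `^ (N%:R + s * p) != 0 by rewrite powR_eq0 negb_and gt_eqF.
  (* The distance vanishes on the diagonal, so the inverse of its power is abstracted before
     [field]. *)
  by move: (enorm _ `^ _)^-1 => e rn0; field.
have C0 : 0 < c^-1 `^ p * r `^ (N%:R + s * p) by rewrite mulr_gt0 ?powR_gt0 ?invr_gt0.
transitivity (lebN (fun x => lebN (fun y =>
    (c^-1 `^ p * r `^ (N%:R + s * p) * K (x0 + r *: x) (x0 + r *: y))%:E))).
  by apply: eq_lebN => x; apply: eq_lebN => y; rewrite E.
apply: etrans (lebN2_affine x0 r0 C0 K0) _; congr (_ * _)%E.
by apply: eq_lebN => x; apply: eq_lebN => y; rewrite !indicT/= !mul1r.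
Qed.

Lemma lebN_eball_fin x0 r (f : 'rV[R]_N -> R) (M : R) :
  0 < r -> 0 <= M ->
  (forall z, 0 <= f z) -> (forall z, eball x0 r z -> f z <= M) ->
  (lebN (fun z => (\1_(eball x0 r) z * f z)%:E) < +oo)%E.
Proof.
move=> r0 M0 f0 fM; apply: le_lt_trans (ltry _).
apply: (lebN_cube_le (c := x0) (ltW r0) M0).
  move=> z; rewrite !lee_fin indicE; case: (boolP (z \in _)) => [/set_mem zb|_].
    by rewrite mul1r f0 fM.
  by rewrite mul0r lexx.
move=> z i zi; rewrite indicE memNset ?mul0r// /eball/= => /(le_lt_trans _) H.
have := H `|z ord0 i - x0 ord0 i|.
rewrite (le_trans _ (normr_coord_le_enorm _ i)); last by rewrite !mxE.
by move=> /(_ isT) /(lt_trans zi); rewrite ltxx.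
Qed.

(** The infimum defining [Lambda] is tested with the rescaled and normalised function [psi]. The
    bound [M] makes the integral [I] finite, so that it can be normalised. *)
Lemma poincare_eball (s p : R) phi x0 r M :
  0 < p -> 0 < r -> smooth phi -> 0 <= M ->
  (forall z, eball x0 r z -> `|phi z - phi x0| <= M) ->
  (Lambda s p (0 : 'rV[R]_N) 1 *
    lebN (fun z => (\1_(eball x0 r) z * `|phi z - phi x0| `^ p)%:E) <=
   (r `^ (s * p))%:E * gagliardo_p s p setT phi)%E.
Proof.
move=> p0 r0 sphi M0 phiM.
set I := lebN _.
have I0 : (0 <= I)%E.
  by apply: lebN_ge0 => z; rewrite lee_fin mulr_ge0 ?powR_ge0.
have Ioo : (I < +oo)%E.
  apply: (@lebN_eball_fin x0 r (fun z => `|phi z - phi x0| `^ p) (M `^ p)) => //.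
  - exact: powR_ge0.
  - by move=> z /phiM zM; apply: ge0_ler_powR; rewrite ?nnegrE ?(ltW p0).
pose i := fine I; have IE : I = i%:E by rewrite fineK// ge0_fin_numE.
have i0 : 0 <= i by exact: fine_ge0.
have G0 := gagliardo_ge0 s p setT phi.
have [i0'|i_gt0] := leP i 0.
  have -> : I = 0%E by rewrite IE; congr EFin; apply/eqP; rewrite eq_le i0' i0.
  by rewrite mule0 mule_ge0// lee_fin powR_ge0.
have rN : 0 < r ^- N by rewrite invr_gt0 exprn_gt0.
(* This is the norm over the unit ball of [phi (x0 + r *: x) - phi x0]; the factor [r ^- N] comes
   from the change of variables. *)
pose c := (i * r ^- N) `^ p^-1.
have J0 : 0 < i * r ^- N by rewrite mulr_gt0.
have c0 : 0 < c by rewrite powR_gt0.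
have cp : c `^ p = i * r ^- N by rewrite -powRrM mulVf ?gt_eqF// powRr1// ltW.
have cip : c^-1 `^ p = (i * r ^- N)^-1.
  by rewrite -powR_inv1 ?ltW// -powRrM mulN1r powRN cp.
pose psi := affine_comp phi x0 r c (phi x0).
pose f (z : 'rV[R]_N) := (\1_(eball x0 r) z * `|phi z - phi x0| `^ p)%:E.
have f0 z : (0 <= f z)%E by rewrite lee_fin mulr_ge0 ?powR_ge0.
have J0' : 0 < (i * r ^- N)^-1 by rewrite invr_gt0.
have norm1 : lebN (fun x => (\1_(eball 0 1) x * `|psi x| `^ p)%:E) = 1%E.
  transitivity (lebN (fun x => (((i * r ^- N)^-1)%:E * f (x0 + r *: x)%R)%E)).
    apply: eq_lebN => x; rewrite /f -EFinM; congr EFin.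
    have -> : \1_(eball 0 1) x = \1_(eball x0 r) (x0 + r *: x) :> R.
      by rewrite !indicE; congr (nat_of_bool _)%:R; apply/idP/idP; rewrite !inE eball_affine.
    rewrite /psi /affine_comp normrM.
    rewrite (gtr0_norm (_ : 0 < c^-1)) ?invr_gt0// powRM ?invr_ge0 ?(ltW c0)// cip.
    by rewrite mulrCA.
  apply: etrans (lebNZl (f := fun x => f (x0 + r *: x)) J0' (fun x => f0 _)) _.
  apply: etrans (congr1 (mule _) (lebN_affine x0 r0 f0)) _.
  by rewrite -/I IE -!EFinM; congr EFin; rewrite [r ^- N * i]mulrC mulVf ?gt_eqF.
have H : (Lambda s p (0 : 'rV[R]_N) 1 <= gagliardo_p s p setT psi)%E.
  apply: le_trans (le_gagliardo_setT s p (eball 0 1) psi).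
  apply: ereal_inf_lbound; exists psi => //; split.
  - exact: C1_closure_affine_comp.
  - by rewrite /Lpnorm norm1 poweR_EFin powR1.
  - by rewrite /psi /affine_comp scaler0 addr0 subrr mulr0.
rewrite (gagliardo_affine_comp s p phi x0 (phi x0) r0 c0) cip in H.
rewrite IE; apply: le_trans (lee_wpmul2r _ H) _; first by rewrite lee_fin.
rewrite muleAC -EFinM; apply: lee_wpmul2r => //; rewrite lee_fin.
rewrite powRD; last by rewrite (gt_eqF r0) implybT.
rewrite powR_mulrn ?(ltW r0)//.
rewrite le_eqVlt; apply/orP; left; apply/eqP.
field.
by rewrite !gt_eqF ?exprn_gt0.
Qed.

End Poincare.

(** * The two-ball estimate *)

Section Key.
Set Implicit Arguments.
Unset Strict Implicit.
Variables (R : realType).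

(** Convexity of the power [p], with [a + b] written as the mean of [(A + B) / A * a] and
    [(A + B) / B * b] with weights [A / (A + B)] and [B / (A + B)]. *)
Lemma powRD_le_weighted (p a b A B : R) :
  1 <= p -> 0 <= a -> 0 <= b -> 0 < A -> 0 < B ->
  (a + b) `^ p <= A / (A + B) * ((A + B) / A) `^ p * a `^ p +
                  B / (A + B) * ((A + B) / B) `^ p * b `^ p.
Proof.
move=> p1 a0 b0 A0 B0; have S0 : 0 < A + B by rewrite addr_gt0.
have t0 : 0 <= A / (A + B) by rewrite divr_ge0 ?ltW.
have t1 : A / (A + B) <= 1 by rewrite ler_pdivrMr// mul1r lerDl ltW.
have SA : 0 <= (A + B) / A by rewrite divr_ge0 ?ltW.
have SB : 0 <= (A + B) / B by rewrite divr_ge0 ?ltW.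
have := @convex_powR R p p1 (Itv01 t0 t1) ((A + B) / A * a) ((A + B) / B * b).
rewrite !inE/= !in_itv/= !andbT (mulr_ge0 SA a0) (mulr_ge0 SB b0) => /(_ isT isT) H; move: H.
rewrite [X in X `^ _ <= _ -> _]convRE [X in _ <= X -> _]convRE/= /unstable.onem.
rewrite (powRM _ SA a0) (powRM _ SB b0).
have -> : 1 - A / (A + B) = B / (A + B) by field; rewrite gt_eqF.
have -> : A / (A + B) * ((A + B) / A * a) + B / (A + B) * ((A + B) / B * b) = a + b.
  by field; rewrite !gt_eqF.
by rewrite !mulrA.
Qed.

Variable N : nat.
Implicit Types (phi : 'rV[R]_N -> R) (x : 'rV[R]_N).

Lemma lscZ (f : 'rV[R]_N -> \bar R) (k : R) :
  0 < k -> lower_semicontinuous f -> lower_semicontinuous (fun x => k%:E * f x)%E.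
Proof.
move=> k0 lf x a; rewrite -lte_pdivrMl// -EFinM => /lf [V xV Va].
by exists V => // y /Va; rewrite EFinM lte_pdivrMl.
Qed.

Lemma Lambda_ge0 s p x (r : R) : (0 <= Lambda s p x r)%E.
Proof. by apply: le_ereal_inf_tmp => _ [phi _ <-]; exact: gagliardo_ge0. Qed.

Lemma omega_ge0 : (0 <= omega R N)%E.
Proof. by apply: lebN_ge0 => x; rewrite lee_fin. Qed.

Lemma lebN_eball x (r : R) : 0 < r ->
  lebN (fun z => (\1_(eball x r) z)%:E) = ((r ^+ N)%:E * omega R N)%E.
Proof.
move=> r0; pose f (z : 'rV[R]_N) := (\1_(eball x r) z : R)%:E.
have f0 z : (0 <= f z)%E by rewrite lee_fin.
have -> : omega R N = lebN (fun z => f (x + r *: z)).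
  apply: eq_lebN => z; rewrite /f !indicE; congr (nat_of_bool _)%:R%:E.
  by apply/idP/idP; rewrite !inE eball_affine.
have -> := lebN_affine x r0 f0.
by rewrite muleA -EFinM mulfV ?mul1e// gt_eqF// exprn_gt0.
Qed.

(** The convexity inequality is integrated over the ball around [y0], where the left side is
    constant and produces the volume [r ^+ N * omega]. This ball lies in the larger one around [x0],
    over which the first integral may be extended. *)
Lemma lebN_two_balls (p r k1 k2 : R) phi x0 y0 :
  0 < p -> 0 < r -> 0 < k1 -> 0 < k2 -> continuous phi ->
  (forall a b : R, 0 <= a -> 0 <= b -> (a + b) `^ p <= k1 * a `^ p + k2 * b `^ p) ->
  ((`|phi x0 - phi y0| `^ p * r ^+ N)%:E * omega R N <=
    k1%:E * lebN (fun z => (\1_(eball x0 (r + enorm (x0 - y0))) z *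
                             `|phi z - phi x0| `^ p)%:E) +
    k2%:E * lebN (fun z => (\1_(eball y0 r) z * `|phi z - phi y0| `^ p)%:E))%E.
Proof.
move=> p0 r0 k10 k20 cphi conv.
set f1 := fun z => (\1_(eball x0 _) z * _)%:E.
set f2 := fun z => (\1_(eball y0 _) z * _)%:E.
pose g (z : 'rV[R]_N) := (\1_(eball y0 r) z : R)%:E.
have f10 z : (0 <= f1 z)%E by rewrite lee_fin mulr_ge0 ?powR_ge0.
have f20 z : (0 <= f2 z)%E by rewrite lee_fin mulr_ge0 ?powR_ge0.
have g0 z : (0 <= g z)%E by rewrite lee_fin.
have lsc_f (x : 'rV[R]_N) e :
    lower_semicontinuous (fun z => (\1_(eball x e) z * `|phi z - phi x| `^ p)%:E).
  apply: lsc_indic_powR p0; first exact: open_eball.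
  by move=> z; exact: (cvgB (cphi z) (cvg_cst _)).
have lf1 : lower_semicontinuous f1 by exact: lsc_f.
have lf2 : lower_semicontinuous f2 by exact: lsc_f.
have pointwise z : ((`|phi x0 - phi y0| `^ p)%:E * g z <= k1%:E * f1 z + k2%:E * f2 z)%E.
  have [zB|zB] := boolP (z \in eball y0 r); last first.
    rewrite /g indicE (negbTE zB) mule0.
    by apply: adde_ge0; apply: mule_ge0; rewrite ?lee_fin ?(ltW k10) ?(ltW k20).
  have zA : z \in eball x0 (r + enorm (x0 - y0)).
    by rewrite inE enormC; exact: sub_eball (set_mem zB).
  have -> : f1 z = (`|phi z - phi x0| `^ p)%:E by rewrite /f1 indicE zA mul1r.
  have -> : f2 z = (`|phi z - phi y0| `^ p)%:E by rewrite /f2 indicE zB mul1r.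
  rewrite /g indicE zB mule1 -!EFinM -EFinD lee_fin.
  apply: le_trans (conv _ _ (normr_ge0 _) (normr_ge0 _)).
  apply: ge0_ler_powR; rewrite ?nnegrE ?(ltW p0) ?addr_ge0//.
  by rewrite [X in _ <= X + _]distrC; exact: ler_distD.
move: lf1 lf2 f10 f20 pointwise; move: f1 f2 => f1 f2 lf1 lf2 f10 f20 pointwise.
have k1f10 z : (0 <= k1%:E * f1 z)%E by rewrite mule_ge0// lee_fin ltW.
have k2f20 z : (0 <= k2%:E * f2 z)%E by rewrite mule_ge0// lee_fin ltW.
rewrite EFinM -muleA -(lebN_eball y0)//.
rewrite -(lebNZl k10 f10) -(lebNZl k20 f20).
rewrite -(lebND (lscZ k10 lf1) (lscZ k20 lf2) k1f10 k2f20).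
(* The constant is pulled out of the integral by [lebNZl], which asks for a positive factor. *)
have [P0|P0] := eqVneq (`|phi x0 - phi y0| `^ p) 0.
  by rewrite P0 mul0e; apply: lebN_ge0 => z; exact: adde_ge0.
have P_gt0 : 0 < `|phi x0 - phi y0| `^ p by rewrite lt_neqAle eq_sym P0 powR_ge0.
rewrite -(lebNZl P_gt0 g0); apply: le_lebN pointwise => z.
by apply: mule_ge0 (g0 z); rewrite lee_fin powR_ge0.
Qed.

Lemma morrey_two_balls (s p al T : R) phi x0 y0 :
  1 < p -> 0 < s -> 0 <= al -> smooth phi ->
  (forall x y, `|phi x - phi y| <= enorm (x - y) `^ al) ->
  1 < T -> x0 != y0 ->
  ((`|phi x0 - phi y0| `^ p * ((T - 1) * enorm (x0 - y0)) ^+ N)%:E *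
     (omega R N * Lambda s p (0 : 'rV[R]_N) 1) <=
   (((T - 1) `^ s + T `^ s) `^ p * enorm (x0 - y0) `^ (s * p))%:E *
     gagliardo_p s p setT phi)%E.
Proof.
move=> p1 s0 al0 sphi holder T1 xy.
have p0 : 0 < p by exact: lt_trans p1.
have d0 : 0 < enorm (x0 - y0) by rewrite enorm_gt0// subr_eq0.
have T0 : 0 < T by exact: lt_trans T1.
have T10 : 0 < T - 1 by rewrite subr_gt0.
have poin x r : 0 < r ->
    (Lambda s p (0 : 'rV[R]_N) 1 *
      lebN (fun z => (\1_(eball x r) z * `|phi z - phi x| `^ p)%:E) <=
    (r `^ (s * p))%:E * gagliardo_p s p setT phi)%E.
  (* The Hölder bound supplies the oscillation bound [r] to the power [al] on a ball of radius
     [r]. *)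
  move=> r0; apply: (@poincare_eball _ _ _ _ _ _ _ (r `^ al)) => //; first exact: powR_ge0.
  move=> z zr; apply: le_trans (holder _ _) _; apply: ge0_ler_powR => //.
  - by rewrite nnegrE enorm_ge0.
  - by rewrite nnegrE ltW.
  - exact: ltW.
have G0 := gagliardo_ge0 s p setT phi.
have L0 := Lambda_ge0 s p 0 1.
have A0 : 0 < T `^ s by rewrite powR_gt0.
have B0 : 0 < (T - 1) `^ s by rewrite powR_gt0.
have conv (a b : R) a0 b0 := powRD_le_weighted (ltW p1) (a := a) (b := b) a0 b0 A0 B0.
move: conv; set k1 := _ * _ `^ p; set k2 := _ * _ `^ p => conv.
have S0 : 0 < T `^ s + (T - 1) `^ s by rewrite addr_gt0.
have k10 : 0 < k1 by rewrite mulr_gt0 ?powR_gt0 ?divr_gt0.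
have k20 : 0 < k2 by rewrite mulr_gt0 ?powR_gt0 ?divr_gt0.
(* With [A] and [B] the powers [s] of [T] and [T - 1], the radii cancel the denominators in [k1] and
   [k2]. The two terms become the fractions [A / (A + B)] and [B / (A + B)] of the left side. *)
have kE : ((T - 1) `^ s + T `^ s) `^ p * enorm (x0 - y0) `^ (s * p) =
   k1 * (T * enorm (x0 - y0)) `^ (s * p) + k2 * ((T - 1) * enorm (x0 - y0)) `^ (s * p).
  rewrite !(powRM (s * p)) ?(ltW T0) ?(ltW T10) ?(ltW d0)// 3!(powRrM _ s p).
  rewrite [X in X `^ p * _]addrC /k1 /k2.
  have e (C : R) : 0 < C -> ((T `^ s + (T - 1) `^ s) / C) `^ p * C `^ p =
      (T `^ s + (T - 1) `^ s) `^ p.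
    by move=> C0; rewrite -powRM ?divr_ge0 ?(ltW S0) ?(ltW C0)// divfK// gt_eqF.
  have aux (a b X Y x y Sp D : R) : a + b != 0 -> X * x = Sp -> Y * y = Sp ->
      Sp * D = a / (a + b) * X * (x * D) + b / (a + b) * Y * (y * D).
    by move=> ab E1 E2; rewrite -[Sp in LHS](mulfK ab) mulrDr -{1}E1 -E2; field.
  exact: aux (lt0r_neq0 S0) (e _ A0) (e _ B0).
have Td : T * enorm (x0 - y0) = (T - 1) * enorm (x0 - y0) + enorm (x0 - y0) by ring.
have r0 : 0 < (T - 1) * enorm (x0 - y0) by rewrite mulr_gt0.
have Td0 : 0 < T * enorm (x0 - y0) by rewrite mulr_gt0.
have split := lebN_two_balls x0 y0 p0 r0 k10 k20 (sphi [::]).1 conv.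
rewrite -Td in split.
have := poin x0 _ Td0; have := poin y0 _ r0.
move: split; rewrite kE; move: G0 L0.
set I1 := lebN (fun z => (\1_(eball x0 _) z * _)%:E).
set I2 := lebN (fun z => (\1_(eball y0 _) z * _)%:E).
have I10 : (0 <= I1)%E.
  by apply: lebN_ge0 => z; rewrite lee_fin mulr_ge0 ?powR_ge0.
have I20 : (0 <= I2)%E.
  by apply: lebN_ge0 => z; rewrite lee_fin mulr_ge0 ?powR_ge0.
move: (Lambda _ _ _ _) (gagliardo_p _ _ _ _) (omega _ _) I1 I2 I10 I20 k1 k2 k10 k20 {conv kE}.
move=> L G w I1 I2 I10 I20 k1 k2 k10 k20 G0 L0 split poin2 poin1.
rewrite muleA muleC; apply: le_trans (lee_wpmul2l L0 split) _.
rewrite ge0_muleDr; [|by rewrite mule_ge0// lee_fin ltW..].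
rewrite !(muleCA L) EFinD ge0_muleDl ?lee_fin; [|by rewrite mulr_ge0 ?powR_ge0// ltW..].
by rewrite !EFinM -!muleA; apply: leeD; rewrite lee_pmul2l ?lte_fin.
Qed.

(** The supremum 1 need not be attained. If [G < V] with [V] finite, some [q] in [S] exceeds the
    [p]-th root of [G / V], which is below 1, and contradicts the bound; if [V] is infinite, any
    positive [q] does. *)
Lemma ereal_sup_cofinal_mul_le (S : set (\bar R)) (p : R) (V G : \bar R) :
  0 < p -> (0 <= V)%E -> (0 <= G)%E -> ereal_sup S = 1%E ->
  (forall q : R, 0 <= q -> S q%:E -> ((q `^ p)%:E * V <= G)%E) ->
  S `<=` [set q%:E | q in [set q : R | 0 <= q]] ->
  (V <= G)%E.
Proof.
move=> p0 V0 G0 S1 H SE; rewrite leNgt; apply/negP => GV.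
have [q Sq VG] : exists2 q : R, 0 <= q /\ S q%:E & (G < (q `^ p)%:E * V)%E; last first.
  by have := H q Sq.1 Sq.2; rewrite leNgt VG.
case: G GV G0 {H} => [g| |]//; last by move=> oV; have := leey V; rewrite leNgt oV.
case: V V0 => [v| |]// V0 gV g0.
- rewrite lte_fin in gV; rewrite lee_fin in g0; have v0 : 0 < v by exact: le_lt_trans gV.
  have gv : (g / v) `^ p^-1 < 1.
    rewrite [ltRHS](_ : _ = 1 `^ p^-1); last by rewrite powR1.
    apply: gt0_ltr_powR; rewrite ?invr_gt0//.
    + by rewrite nnegrE divr_ge0// ltW.
    + by rewrite nnegrE.
    + by rewrite ltr_pdivrMr// mul1r.
  have : (((g / v) `^ p^-1)%:E < ereal_sup S)%E by rewrite S1 lte_fin.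
  move=> /ereal_sup_gt [y Sy]; have [q /= q0 qy] := SE _ Sy.
  rewrite -qy in Sy *; rewrite lte_fin => gq; exists q => //.
  rewrite -EFinM lte_fin -ltr_pdivrMr//.
  rewrite -[X in X < _](_ : ((g / v) `^ p^-1) `^ p = _); last first.
    by rewrite -powRrM mulVf ?gt_eqF// powRr1// divr_ge0// ltW.
  by apply: gt0_ltr_powR => //; rewrite nnegrE powR_ge0.
- have : (0 < ereal_sup S)%E by rewrite S1.
  move=> /ereal_sup_gt [y Sy y0]; have [q /= q0 qy] := SE _ Sy.
  rewrite -qy in Sy y0; exists q => //.
  by rewrite gt0_muley ?ltry// lte_fin powR_gt0.
Qed.

End Key.

Theorem theorem4p2 (R : realType) (N : nat) (s p : R) :
  (1 <= N)%N -> 0 < s < 1 -> 1 < p -> N%:R < s * p ->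
  (theta N s p * Lambda s p (0 : 'rV[R]_N) 1 <= morrey_const N s p)%E.
Proof.
move=> _ /andP[s0 _] p1 Nsp.
have p0 : 0 < p by exact: lt_trans p1.
have al0 : 0 <= s - N%:R / p by rewrite subr_ge0 ler_pdivrMr// ltW.
apply: le_ereal_inf_tmp => _ [phi [sphi _ phi1] <-].
have holder (x y : 'rV[R]_N) : `|phi x - phi y| <= enorm (x - y) `^ (s - N%:R / p).
  have [->|xy] := eqVneq x y; first by rewrite subrr normr0 powR_ge0.
  have e0 : 0 < enorm (x - y) by rewrite enorm_gt0// subr_eq0.
  rewrite -[leRHS]mul1r -ler_pdivrMr ?powR_gt0// -lee_fin -phi1.
  by apply: ereal_sup_ubound; exists (x, y) => //; split => //; exact/eqP.
have G0 := gagliardo_ge0 s p setT phi.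
have W0 : (0 <= omega R N * Lambda s p (0 : 'rV[R]_N) 1)%E.
  by apply: mule_ge0; [exact: omega_ge0|exact: Lambda_ge0].
have key (T : R) : 1 < T ->
    (((T - 1) ^+ N / ((T - 1) `^ s + T `^ s) `^ p)%:E *
      (omega R N * Lambda s p (0 : 'rV[R]_N) 1) <= gagliardo_p s p setT phi)%E.
  move=> T1; have T0 : 0 < T by exact: lt_trans T1.
  have T10 : 0 < T - 1 by rewrite subr_gt0.
  have S0 : 0 < (T - 1) `^ s + T `^ s by rewrite addr_gt0 ?powR_gt0.
  (* For fixed [T], [S] is the set of Hölder quotients of [phi], with supremum 1 by normalisation.
     The two-ball estimate bounds each quotient to the power [p] times the left side. *)
  apply: (ereal_sup_cofinal_mul_le p0 _ G0 phi1).
  - by apply: mule_ge0 W0; rewrite lee_fin divr_ge0 ?exprn_ge0 ?powR_ge0 ?(ltW T10).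
  - move=> _ _ [[x y] [_ _ /eqP xy] [<-]].
    have /= := morrey_two_balls p1 s0 al0 sphi holder T1 xy.
    have d0 : 0 < enorm (x - y) by rewrite enorm_gt0// subr_eq0.
    move: (omega R N * _)%E (gagliardo_p _ _ _ _) => W G key.
    rewrite muleA -EFinM.
    rewrite [X in (X%:E * W)%E](_ : _ =
      (((T - 1) `^ s + T `^ s) `^ p * enorm (x - y) `^ (s * p))^-1 *
      (`|phi x - phi y| `^ p * ((T - 1) * enorm (x - y)) ^+ N)).
      by rewrite EFinM -muleA lee_pdivrMl// mulr_gt0 ?powR_gt0.
    rewrite powRM ?invr_ge0 ?powR_ge0//.
    have -> : (enorm (x - y) `^ (s - N%:R / p))^-1 `^ p =
        (enorm (x - y) `^ ((s - N%:R / p) * p))^-1.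
      by rewrite -powR_inv1 ?powR_ge0// -powRrM mulN1r powRN -powRrM.
    (* Splitting the exponent isolates the [N]-th power of the distance, which cancels against the
       one from the volume of the ball; the Hölder exponent times [p] remains. *)
    rewrite (_ : s * p = (s - N%:R / p) * p + N%:R); last first.
      by rewrite mulrBl divfK ?gt_eqF// subrK.
    rewrite powRD; last by rewrite (gt_eqF d0) implybT.
    rewrite powR_mulrn ?(ltW d0)// exprMn.
    have : enorm (x - y) ^+ N != 0 by rewrite expf_neq0 ?gt_eqF.
    have : enorm (x - y) `^ ((s - N%:R / p) * p) != 0 by rewrite gt_eqF ?powR_gt0.
    have : ((T - 1) `^ s + T `^ s) `^ p != 0 by rewrite gt_eqF ?powR_gt0.
    move: (_ `^ ((s - _) * p)) (_ ^+ N) (_ `^ p) (_ ^+ N) (_ `^ p) => a b c d e c0 a0 b0.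
    by field; rewrite ?a0 ?b0 ?c0.
  - move=> _ [[x y] _ <-] /=; exists (`|phi x - phi y| / enorm (x - y) `^ (s - N%:R / p)) => //=.
    by rewrite divr_ge0 ?powR_ge0.
(* Grouping [omega] with [Lambda] leaves one constant [w] in front of the supremum over [T]; a
   finite positive [w] can be divided out. *)
rewrite /theta muleAC.
move: (omega R N * _)%E W0 key => [w| |]// W0 key.
- rewrite lee_fin le_eqVlt in W0; case/predU1P : W0 => [<-|w0].
    by rewrite mul0e.
  rewrite -lee_pdivlMl//; apply: ge_ereal_sup => _ [T T1 <-].
  by rewrite lee_pdivlMl// muleC; exact: key.
(* If [w] is infinite, the single value [T = 2], whose coefficient is positive, already forces the
   seminorm to be infinite. *)
- have := key 2 ltac:(by rewrite ltr1n).
  rewrite (_ : 2 - 1 = 1 :> R); last by ring.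
  rewrite gt0_muley; last first.
    by rewrite lte_fin expr1n mul1r invr_gt0 powR_gt0// addr_gt0// powR_gt0.
  by rewrite leye_eq => /eqP ->; exact: leey.
Qed.
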